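(* Let $P$ be a non-empty finite set of primes, let $q$ be the minimum element of $P$, and let $p\in P$ be an element with minimum value of $\|p\|_{\log}$ among elements of $P$. Then: (1) the set $\{\|n\|_{P,\log} : n>1\}$ is dense in the interval $\left(\|p\|_{\log},\ \|q\|_{\log}+\frac{q-1}{\log_3 q}\right)$, i.e. every non-empty open subinterval of it contains a value $\|n\|_{P,\log}$ for some integer $n>1$; (2) for every $\epsilon>0$ there exist only finitely many integers $n>1$ such that $3 \leq \|n\|_{P,\log} < \|p\|_{\log}-\epsilon$.
   Context: For a positive integer $m$, $\|m\|$ denotes the minimum number of occurrences of the constant $1$ in an arithmetic expression built only from the constant $1$, addition, multiplication and parentheses whose value is $m$; for $m>1$, $\|m\|_{\log}=\|m\|/\log_3 m$. Given a non-empty finite set $P$ of primes, the $P$-algorithm builds an expression for $n>0$ as follows: (1) if $n=1$, represent $n$ as $1$ and stop; (2) if $n=p\in P$, represent $n$ by a shortest expression of $p$ (with $\|p\|$ ones) and stop; (3) if $n>1$, $n\notin P$ and $n$ is divisible by some $p\in P$, represent $n$ as (shortest expression of $p$)$\cdot\frac{n}{p}$ and continue with $\frac{n}{p}$; (4) if $n>1$ and $n$ is divisible by no $p\in P$, represent $n$ as $1+(n-1)$ and continue with $n-1$. The number of ones in the resulting expression does not depend on the choices made in step (3); it is denoted $\|n\|_P$. Equivalently: $\|1\|_P=1$; $\|p\|_P=\|p\|$ for $p\in P$; $\|n\|_P=\|p\|+\|n/p\|_P$ if $n>1$, $n\notin P$, $p\in P$, $p\mid n$; $\|n\|_P = 1+\|n-1\|_P$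 if $n>1$ is divisible by no element of $P$. For $n>1$, $\|n\|_{P,\log}=\|n\|_P/\log_3 n$. *)

(* Defs.v *)
From mathcomp Require Import all_boot all_order all_algebra finmap.
From mathcomp Require Import mathcomp_extra boolp classical_sets functions
  cardinality reals exp.

Set Implicit Arguments.
Unset Strict Implicit.
Unset Printing Implicit Defensive.

Import Order.TTheory GRing.Theory Num.Theory.

Local Open Scope fset_scope.
Local Open Scope classical_set_scope.
Local Open Scope nat_scope.

Inductive expr : Type :=
  | One
  | Add of expr & expr
  | Mul of expr & expr.

Fixpoint value (e : expr) : nat :=
  match e with
  | One => 1
  | Add a b => value a + value b
  | Mul a b => value a * value b
  end.

Fixpoint ones (e : expr) : nat :=
  match e with
  | One => 1
  | Add a b => ones a + ones b
  | Mul a b => ones a + ones b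
  end.

Definition shortest (m : nat) (e : expr) : Prop :=
  value e = m /\ forall e', value e' = m -> ones e <= ones e'.

(* No expression has value 0; the junk value is [complexity 0 = 0]. *)
Definition complexity (m : nat) : nat :=
  xget 0 [set k | exists2 e, shortest m e & ones e = k].

(* [Palgorithm P n e]: some run of the P-algorithm on n outputs e.  The choices
   of a shortest expression and of the prime to divide by are left free. *)
Inductive Palgorithm (P : {fset nat}) : nat -> expr -> Prop :=
  | Palg_one : Palgorithm P 1 One
  | Palg_mem (p : nat) e : p \in P -> shortest p e -> Palgorithm P p e
  | Palg_div (n p : nat) e f : 1 < n -> n \notin P -> p \in P -> p %| n ->
      shortest p e -> Palgorithm P (n %/ p) f -> Palgorithm P n (Mul e f)
  | Palg_sub n f : 1 < n -> (forall p : nat, p \in P -> ~~ (p %| n)) ->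
      Palgorithm P n.-1 f -> Palgorithm P n (Add One f).

(* When P consists of primes and n > 0, runs on n exist and all of them use the
   same number of ones: see [complexityP_run] and [Palgorithm_total]. *)
Definition complexityP (P : {fset nat}) (n : nat) : nat :=
  xget 0 [set k | exists2 e, Palgorithm P n e & ones e = k].

Lemma shortest_exists m : 0 < m -> exists e, shortest m e.
Proof.
move=> m0; have [e0 e0m] : exists e, value e = m.
  case: m m0 => // m _; elim: m => [|m [e em]]; first by exists One.
  by exists (Add One e); rewrite /= em.
have hex : exists k, `[< exists2 e, value e = m & ones e = k >].
  by exists (ones e0); apply/asboolP; exists e0.
case: (ex_minnP hex) => k /asboolP[e em ek] kmin.
exists e; split=> // e' e'm; rewrite ek; apply: kmin.
by apply/asboolP; exists e'.
Qed.

Lemma complexity_shortest m e : shortest m e -> complexity m = ones e.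
Proof.
move=> [em emin]; rewrite /complexity; case: xgetP => [k _ [f [fm fmin] <-]|].
  by apply/eqP; rewrite eqn_leq fmin // emin.
by move/(_ (ones e)) => /=; case; exists e.
Qed.

Lemma Palgorithm_total (P : {fset nat}) n :
  (forall p : nat, p \in P -> prime p) -> 0 < n -> exists e, Palgorithm P n e.
Proof.
move=> primeP; elim/ltn_ind: n => n IH n0.
have [n1|n1] := leqP n 1.
  exists One; have -> : n = 1 by apply/eqP; rewrite eqn_leq n1 n0.
  exact: Palg_one.
have [nP|nP] := boolP (n \in P).
  by have [e se] := shortest_exists n0; exists e; apply: Palg_mem.
have [[p pP pn]|np] := pselect (exists2 p : nat, p \in P & p %| n).
  have p1 := prime_gt1 (primeP _ pP); have p0 := ltnW p1.
  have np0 : 0 < n %/ p by rewrite divn_gt0 // dvdn_leq.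
  have [f fP] := IH _ (ltn_Pdiv p1 n0) np0.
  have [e se] := shortest_exists p0.
  by exists (Mul e f); apply: Palg_div se fP.
have [||f fP] := IH n.-1; [by rewrite prednK | by rewrite -ltnS prednK |].
exists (Add One f); apply: Palg_sub => // p pP; apply/negP => pn.
by apply: np; exists p.
Qed.

Lemma Palgorithm_inv (P : {fset nat}) n e : Palgorithm P n e ->
  [\/ n = 1 /\ e = One,
      n \in P /\ shortest n e,
      [/\ 1 < n, n \notin P & exists p a f, [/\ p \in P, p %| n, shortest p a,
        Palgorithm P (n %/ p) f & e = Mul a f]]
    | [/\ 1 < n, forall p : nat, p \in P -> ~~ (p %| n) &
        exists2 f, Palgorithm P n.-1 f & e = Add One f]].
Proof.
case=> [|p a pP sa|m p a f m1 mP pP pm sa fP|m f m1 mP fP].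
- exact: Or41.
- exact: Or42.
- by apply: Or43; split=> //; exists p, a, f.
- by apply: Or44; split=> //; exists f.
Qed.

Lemma shortest_ones m e f : shortest m e -> shortest m f -> ones e = ones f.
Proof. by move=> /complexity_shortest <- /complexity_shortest. Qed.

Lemma Palgorithm_ones (P : {fset nat}) n e f : (forall p : nat, p \in P -> prime p) ->
  Palgorithm P n e -> Palgorithm P n f -> ones e = ones f.
Proof.
move=> primeP; elim/ltn_ind: n e f => n IH e f.
have one_notin : 1 \notin P by apply/negP => /primeP.
move=> /Palgorithm_inv [[-> ->]|[nP se]|[n1 nP [p [a [g [pP pn sa gP ->]]]]]
    |[n1 nP [g gP ->]]] /Palgorithm_inv [[n1' ->]|[nP' sf]
    |[n1' nP' [p' [a' [g' [pP' pn' sa' gP' ->]]]]]|[n1' nP' [g' gP' ->]]] //.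
- by rewrite nP' in one_notin.
- by rewrite n1' in nP; rewrite nP in one_notin.
- exact: shortest_ones se sf.
- by rewrite nP in nP'.
- by have := nP' _ nP; rewrite dvdnn.
- by rewrite n1' in n1.
- by rewrite nP' in nP.
- have pp := primeP _ pP; have pp' := primeP _ pP'.
  have n0 := ltnW n1; rewrite /=.
  have lt := ltn_Pdiv (prime_gt1 pp) n0.
  have lt' := ltn_Pdiv (prime_gt1 pp') n0.
  have [eqp|nep] := eqVneq p p'.
    rewrite -eqp in sa' gP'.
    by rewrite (shortest_ones sa sa') (IH _ lt _ _ gP gP').
  have /dvdnP[d nE] : p * p' %| n.
    by rewrite Gauss_dvd ?pn ?pn' // prime_coprime // dvdn_prime2.
  have d0 : 0 < d by move: n0; rewrite nE muln_gt0 => /andP[].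
  have np : n %/ p = d * p' by rewrite nE mulnCA mulKn ?prime_gt0.
  have np' : n %/ p' = d * p by rewrite nE mulnA mulnK ?prime_gt0.
  have [h hP] := Palgorithm_total primeP d0.
  have key r b c : r \in P -> shortest r b -> d * r < n ->
      Palgorithm P (d * r) c -> ones c = ones b + (if d == 1 then 0 else ones h).
    move=> rP sb ltrn cP; have pr := primeP _ rP; have r0 := prime_gt0 pr.
    case: (eqVneq d 1) => [d1|d1].
      move: cP ltrn; rewrite d1 mul1n addn0 => cP ltrn.
      by apply: (IH _ ltrn c b) => //; apply: Palg_mem.
    apply: (IH _ ltrn c (Mul b h)) => //; apply: (Palg_div _ _ rP) => //.
    - by rewrite (leq_trans (prime_gt1 pr)) // leq_pmull.
    - apply/negP => /primeP drp; case/negP: d1.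
      have := dvdn_mull d (dvdnn r); rewrite dvdn_prime2 // => /eqP rE.
      by rewrite -(eqn_pmul2r r0) mul1n -rE.
    - exact: dvdn_mull.
    - by rewrite mulnK.
  rewrite np in gP lt; rewrite np' in gP' lt'.
  rewrite (key _ _ _ pP' sa' lt gP) (key _ _ _ pP sa lt' gP') /=.
  by rewrite addnCA.
- by have := nP' _ pP; rewrite pn.
- by rewrite n1' in n1.
- by have := nP _ nP'; rewrite dvdnn.
- by have := nP _ pP'; rewrite pn'.
- by rewrite /= (IH n.-1 _ _ _ gP gP') // prednK // ltnW.
Qed.

Lemma complexityP_run (P : {fset nat}) n e : (forall p : nat, p \in P -> prime p) ->
  Palgorithm P n e -> complexityP P n = ones e.
Proof.
move=> primeP eP; rewrite /complexityP; case: xgetP => [k _ [f fP <-]|].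
  exact: Palgorithm_ones fP eP.
by move/(_ (ones e)) => /=; case; exists e.
Qed.

Lemma complexityP1 (P : {fset nat}) : (forall p : nat, p \in P -> prime p) ->
  complexityP P 1 = 1.
Proof. by move=> primeP; apply: (complexityP_run primeP (Palg_one P)). Qed.

Lemma complexityP_mem (P : {fset nat}) (p : nat) : (forall p : nat, p \in P -> prime p) ->
  p \in P -> complexityP P p = complexity p.
Proof.
move=> primeP pP; have [e se] := shortest_exists (prime_gt0 (primeP _ pP)).
by rewrite (complexity_shortest se) (complexityP_run primeP (Palg_mem pP se)).
Qed.

Lemma complexityP_div (P : {fset nat}) (n p : nat) : (forall p : nat, p \in P -> prime p) ->
  1 < n -> n \notin P -> p \in P -> p %| n ->
  complexityP P n = complexity p + complexityP P (n %/ p).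
Proof.
move=> primeP n1 nP pP pn; have p0 := prime_gt0 (primeP _ pP).
have [e se] := shortest_exists p0.
have np0 : 0 < n %/ p by rewrite divn_gt0 // dvdn_leq // ltnW.
have [f fP] := Palgorithm_total primeP np0.
rewrite (complexity_shortest se) (complexityP_run primeP fP).
by rewrite (complexityP_run primeP (Palg_div n1 nP pP pn se fP)).
Qed.

Lemma complexityP_sub (P : {fset nat}) n : (forall p : nat, p \in P -> prime p) ->
  1 < n -> (forall p : nat, p \in P -> ~~ (p %| n)) ->
  complexityP P n = 1 + complexityP P n.-1.
Proof.
move=> primeP n1 nP; have n0 : 0 < n.-1 by rewrite -ltnS prednK // ltnW.
have [f fP] := Palgorithm_total primeP n0.
by rewrite (complexityP_run primeP fP) (complexityP_run primeP (Palg_sub n1 nP fP)).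
Qed.

Local Open Scope ring_scope.

Definition log3 {R : realType} (x : R) : R := ln x / ln 3.

Definition logcomplexity (R : realType) (m : nat) : R :=
  (complexity m)%:R / log3 m%:R.

Definition logcomplexityP (R : realType) (P : {fset nat}) (n : nat) : R :=
  (complexityP P n)%:R / log3 n%:R.

(* Main.v *)
Require Import Defs.
From mathcomp Require Import all_boot all_order all_algebra finmap.
From mathcomp Require Import mathcomp_extra boolp classical_sets functions
  cardinality reals exp.
From mathcomp Require Import sequences lra zify.

(** If every element of [P] divides [m], then on [q ^ k * m - 1] the algorithm
    runs through [k] rounds of [q - 1] subtractions followed by one division by
    [q]: for [0 < i < q], no element of [P] divides [q ^ k * m - i].  Multiplying
    by [p ^ j] adds [j] divisions of the cheapest kind.  The values on [p ^ j * (q ^ k * m - 1)]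
    start near the upper end point for [j = 0], tend to the lower one as [j]
    grows, and move by small steps when [k] is large: hence density.

    For the second part, a division by [r] pays for the decrease of [log3 n] at
    rate at least [logcomplexity p], and so does a subtraction once [n] is large,
    because [log3 n - log3 (n - 1)] tends to [0].  Therefore
    [complexityP P n >= logcomplexity p * log3 n - K] for a constant [K]. *)

Set Implicit Arguments.
Unset Strict Implicit.
Unset Printing Implicit Defensive.

Import Order.TTheory GRing.Theory Num.Theory.
Local Open Scope fset_scope.
Local Open Scope classical_set_scope.
Local Open Scope ring_scope.

(** * Runs of the algorithm on products and just below common multiples of [P] *)

Section Algorithm.
Local Open Scope nat_scope.
Variable P : {fset nat}.
Hypothesis P_prime : forall r : nat, r \in P -> prime r.

(** Since [1 < x], the product [r * x] is composite, hence outside [P], and rule (3) applies. At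
    [x = 1] rule (2) would stop the run without the final one. *)
Lemma complexityP_mulr (r x : nat) : r \in P -> 1 < x ->
  complexityP P (r * x) = complexity r + complexityP P x.
Proof.
move=> rP x1; have pr := P_prime rP; have r1 := prime_gt1 pr.
rewrite (@complexityP_div _ _ r) ?mulKn ?dvdn_mulr ?prime_gt0 //; first by nia.
apply/negP => /P_prime prx; have := dvdn_mulr x (dvdnn r).
by rewrite dvdn_prime2 // => /eqP; nia.
Qed.

Lemma complexityP_expMr (r j x : nat) : r \in P -> 1 < x ->
  complexityP P (r ^ j * x) = j * complexity r + complexityP P x.
Proof.
move=> rP x1; elim: j => [|j IH]; first by rewrite expn0 mul1n.
have rj0 : 0 < r ^ j by rewrite expn_gt0 prime_gt0 ?P_prime.
by rewrite expnS -mulnA complexityP_mulr // ?IH ?mulSn ?addnA //; nia.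
Qed.

(** The numbers [N - 1], ..., [N - i] are nonzero modulo each [r] in [P], because [r] divides [N]
    and exceeds [i]; each of them forces a subtraction. *)
Lemma complexityP_subn (N i : nat) :
  (forall r : nat, r \in P -> r %| N /\ i < r) -> i.+1 < N ->
  complexityP P N.-1 = i + complexityP P (N - i.+1).
Proof.
elim: i => [|i IH] hP iN; first by rewrite subn1.
rewrite IH ?(ltnW iN) //; last by move=> r /hP[? /ltnW].
rewrite complexityP_sub //; last 2 first.
- by lia.
- move=> r /hP[rN ir]; rewrite dvdn_subr ?(ltnW (ltnW iN)) //.
  by apply/negP => /dvdn_leq; lia.
by rewrite [in RHS]subnS addnA addn1.
Qed.

Lemma complexityP_expM_pred (q k m : nat) : q \in P ->
  (forall r : nat, r \in P -> q <= r) -> (forall r : nat, r \in P -> r %| m) ->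
  2 < m ->
  complexityP P (q ^ k * m).-1 =
  k * (complexity q + q.-1) + complexityP P m.-1.
Proof.
move=> qP qmin mP m2; elim: k => [|k IH]; first by rewrite expn0 mul1n.
have q1 := prime_gt1 (P_prime qP).
have qk0 : 0 < q ^ k by rewrite expn_gt0 ltnW.
have N2 : 2 < q ^ k * m by nia.
rewrite expnS -mulnA (@complexityP_subn (q * (q ^ k * m)) q.-1); last 2 first.
- move=> r rP; split; first by rewrite !dvdn_mull // mP.
  by have := qmin _ rP; lia.
- by nia.
(* After [q - 1] subtractions the run stands at a multiple of [q], whose quotient is the same kind
   of number with [k] lowered by one. *)
have -> : q * (q ^ k * m) - q.-1.+1 = q * (q ^ k * m).-1 by nia.
by rewrite complexityP_mulr // ?IH ?mulSn; lia.
Qed.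

End Algorithm.

Lemma expM_pred_ge (q k m : nat) : (0 < q)%N -> (2 < m)%N ->
  (1 < (q ^ k * m).-1)%N /\ (q ^ k <= (q ^ k * m).-1)%N.
Proof.
move=> q0 m2; have : (0 < q ^ k)%N by rewrite expn_gt0 q0.
by move: (q ^ k)%N => y y0; nia.
Qed.

(** * Base-3 logarithms of natural numbers *)

Section Log3.
Variable R : realType.

Lemma ln3_gt0 : 0 < ln (3 : R).
Proof. by rewrite ln_gt0 // ltr1n. Qed.

Lemma log3_gt0 n : (1 < n)%N -> 0 < log3 (n%:R : R).
Proof. by move=> n1; rewrite divr_gt0 ?ln3_gt0 // ln_gt0 // ltr1n. Qed.

Lemma log3_ge0 n : 0 <= log3 (n%:R : R).
Proof.
case: n => [|n]; first by rewrite /log3 ln0 ?mul0r.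
by rewrite divr_ge0 ?(ltW ln3_gt0) // ln_ge0 // ler1n.
Qed.

Lemma ler_log3 m n : (0 < m)%N -> (m <= n)%N ->
  log3 (m%:R : R) <= log3 n%:R.
Proof.
move=> m0 mn; rewrite ler_pM2r ?invr_gt0 ?ln3_gt0 // ler_ln ?ler_nat //;
  by rewrite posrE ltr0n // (leq_trans m0).
Qed.

Lemma log3M m n : (0 < m)%N -> (0 < n)%N ->
  log3 ((m * n)%:R : R) = log3 m%:R + log3 n%:R.
Proof. by move=> m0 n0; rewrite /log3 natrM lnM ?posrE ?ltr0n // mulrDl. Qed.

Lemma log3X m k : (0 < m)%N -> log3 ((m ^ k)%:R : R) = k%:R * log3 m%:R.
Proof.
by move=> m0; rewrite /log3 natrX lnXn ?ltr0n // -[ln _ *+ k]mulr_natl mulrA.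
Qed.

Lemma log3S_le n : (0 < n)%N ->
  log3 (n.+1%:R : R) <= log3 n%:R + (n%:R * ln 3)^-1.
Proof.
move=> n0; have n0R : 0 < n%:R :> R by rewrite ltr0n.
have -> : n.+1%:R = n%:R * (1 + n%:R^-1) :> R.
  by rewrite mulrDr mulr1 divff ?gt_eqF // natr1.
have V0 : 0 < n%:R^-1 :> R by rewrite invr_gt0.
rewrite /log3 lnM ?posrE //; last by lra.
rewrite mulrDl lerD2l invfM ler_pM2r ?invr_gt0 ?ln3_gt0 //.
by apply: le_ln1Dx; lra.
Qed.

End Log3.

(** * Density of the values *)

(** Take the least [j] whose quotient is below [b]; one exists since [A / al < b]. For [j = 0] the
    quotient exceeds [a] by assumption. Otherwise the previous quotient is at least [b], and adding
    [al] to the denominator cannot bring it down to [a], as [a * al < (b - a) * F]. *)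
Lemma ratio_between (R : realType) (a b A al E F : R) : 0 <= a -> a < b -> 0 <= A ->
  A < b * al -> 0 < al -> a * F < E -> a * al < (b - a) * F ->
  exists j : nat, a * (j%:R * al + F) < j%:R * A + E < b * (j%:R * al + F).
Proof.
move=> a0 ab A0 Ab al0 aFE aF.
have hex : exists j : nat, j%:R * A + E < b * (j%:R * al + F).
  have d0 : 0 < b * al - A by rewrite subr_gt0.
  exists (Num.truncn ((E - b * F) / (b * al - A))).+1.
  by have := truncnS_gt ((E - b * F) / (b * al - A)); rewrite ltr_pdivrMr //; lra.
case: (ex_minnP hex) => j jb jmin; exists j; rewrite jb andbT.
case: j jb jmin => [|j] jb jmin; first by rewrite !mul0r !add0r.
have : ~~ (j%:R * A + E < b * (j%:R * al + F)).
  by apply/negP => /jmin; rewrite ltnn.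
have d0 : 0 <= b - a by rewrite subr_ge0 ltW.
have j0 : 0 <= j%:R * ((b - a) * al) by rewrite !mulr_ge0 ?(ltW al0) ?ler0n.
by rewrite -leNgt -natr1; lra.
Qed.

Lemma logcomplexity_log3 (R : realType) (m : nat) : (1 < m)%N ->
  logcomplexity R m * log3 m%:R = (complexity m)%:R.
Proof. by move=> m1; rewrite divfK // gt_eqF // log3_gt0. Qed.

Lemma logcomplexityP_dense (R : realType) (P : {fset nat}) (q p : nat) (a b : R) :
  (forall r : nat, r \in P -> prime r) -> q \in P ->
  (forall r : nat, r \in P -> (q <= r)%N) -> p \in P ->
  logcomplexity R p <= a -> a < b ->
  b <= logcomplexity R q + (q%:R - 1) / log3 q%:R ->
  exists n : nat, (1 < n)%N /\ a < logcomplexityP R P n < b.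
Proof.
move=> P_prime qP qmin pP pa ab bU.
have q1 := prime_gt1 (P_prime _ qP); have p1 := prime_gt1 (P_prime _ pP).
have [m m2 mP] : exists2 m, (2 < m)%N & forall r : nat, r \in P -> (r %| m)%N.
  (* The factor 3 secures [2 < m] even for [P = {2}]. *)
  exists (3 * \prod_(r <- P) r)%N => [|r rP].
    by rewrite leq_pmulr // big_seq prodn_cond_gt0 // => r /P_prime/prime_gt0.
  by rewrite dvdn_mull // (big_rem r) //= dvdn_mulr.
set B : R := (complexity q + q.-1)%:R.
set be : R := log3 q%:R; have be0 : 0 < be by apply: log3_gt0.
set al : R := log3 p%:R; have al0 : 0 < al by apply: log3_gt0.
(* [B] is the cost of one round of [q - 1] subtractions and a division by [q], so [B / be] is the
   upper end point. *)
have abB : b * be <= B.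
  rewrite -ler_pdivlMr // (le_trans bU) // /B natrD [leRHS]mulrDl lerD2l.
  by rewrite -subn1 natrB // ltnW.
have a0 : 0 <= a by apply: le_trans pa; rewrite divr_ge0 ?log3_ge0.
have d0 : 0 < (b - a) * be by rewrite mulr_gt0 ?subr_gt0.
set mu : R := log3 m%:R; have mu0 : 0 <= mu := log3_ge0 _ _.
(* The term [a * mu] serves [a * F < E], and [a * al] serves the small-step condition of
   [ratio_between]. *)
have [k kbig] : exists k : nat, a * mu + a * al < k%:R * ((b - a) * be).
  exists (Num.truncn ((a * mu + a * al) / ((b - a) * be))).+1.
  by rewrite -ltr_pdivrMr //; exact: truncnS_gt.
have am0 : 0 <= a * mu by rewrite mulr_ge0.
have aal0 : 0 <= a * al by rewrite mulr_ge0 // ltW.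
pose x := (q ^ k * m).-1; set F : R := log3 x%:R.
have qk0 : (0 < q ^ k)%N by rewrite expn_gt0 ltnW.
have [x1 qk_le] : (1 < x)%N /\ (q ^ k <= x)%N := expM_pred_ge k (ltnW q1) m2.
have F_ge : k%:R * be <= F.
  by rewrite -log3X ?(ltnW q1) // ler_log3.
have F_le : F <= k%:R * be + mu.
  rewrite -log3X ?(ltnW q1) // -log3M ?(ltnW (ltnW m2)) //.
  by rewrite ler_log3 ?leq_pred // ltnW.
set E : R := (complexityP P x)%:R.
have E_ge : k%:R * B <= E.
  by rewrite -natrM ler_nat complexityP_expM_pred // leq_addr.
have kb0 : k%:R * (b * be) <= k%:R * B by rewrite ler_wpM2l.
have aF_le : a * F <= a * (k%:R * be + mu) by rewrite ler_wpM2l.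
have bF_ge : (b - a) * (k%:R * be) <= (b - a) * F.
  by rewrite ler_wpM2l // subr_ge0 ltW.
have [| | | |j jP] := @ratio_between R a b (complexity p)%:R al E F a0 ab _ _ al0.
- exact: ler0n.
- by rewrite -logcomplexity_log3 // ltr_pM2r // (le_lt_trans pa).
- by lra.
- by lra.
exists (p ^ j * x)%N.
have pj0 : (0 < p ^ j)%N by rewrite expn_gt0 ltnW.
have n1 : (1 < p ^ j * x)%N by rewrite (leq_trans x1) // leq_pmull.
split=> //; rewrite ltr_pdivlMr ?ltr_pdivrMr ?log3_gt0 //.
by rewrite log3M ?log3X ?(ltnW p1) ?(ltnW x1) // complexityP_expMr // natrD natrM.
Qed.

(** * Logarithmic lower bound and finiteness *)

Lemma complexityP_ge (R : realType) (P : {fset nat}) (L : R) :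
  (forall r : nat, r \in P -> prime r) -> 0 <= L ->
  (forall r : nat, r \in P -> L <= logcomplexity R r) ->
  exists K : R, forall n : nat, (0 < n)%N ->
    L * log3 n%:R - K <= (complexityP P n)%:R.
Proof.
move=> P_prime L0 Lmin.
have Lr (r : nat) : r \in P -> L * log3 r%:R <= (complexity r)%:R.
  move=> rP; have r1 := prime_gt1 (P_prime _ rP).
  by rewrite -logcomplexity_log3 // ler_pM2r ?Lmin // log3_gt0.
(* Beyond [n0], one subtraction lowers [L * log3 n] by at most 1, which is its cost. Up to [n0], the
   choice [K = L * log3 n0] makes the bound nonpositive. *)
pose n0 := (Num.truncn (L / ln 3)).+2.
have K0 : 0 <= L * log3 (n0%:R : R) by rewrite mulr_ge0 ?log3_ge0.
exists (L * log3 n0%:R); elim/ltn_ind => n IH npos.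
have [nn0|n0n] := leqP n n0.
  by rewrite (le_trans _ (ler0n _ _)) // subr_le0 ler_wpM2l // ler_log3.
have n1 : (1 < n)%N by rewrite (leq_trans _ n0n).
have [nP|nP] := boolP (n \in P).
  by rewrite complexityP_mem // (le_trans _ (Lr _ nP)) // gerBl.
have [[r rP rn]|np] := pselect (exists2 r : nat, r \in P & (r %| n)%N).
  have r1 := prime_gt1 (P_prime _ rP); have r0 := ltnW r1.
  have d0 : (0 < n %/ r)%N by rewrite divn_gt0 // dvdn_leq.
  rewrite (complexityP_div P_prime n1 nP rP rn) natrD.
  have := IH _ (ltn_Pdiv r1 npos) d0; have := Lr _ rP.
  by rewrite -{3}(divnK rn) log3M //; lra.
rewrite complexityP_sub //; last first.
  by move=> r rP; apply/negP => rn; apply: np; exists r.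
case: n IH npos n0n n1 {nP np} => // n IH _ n0n; rewrite ltnS => npos.
rewrite natrD /=; have := IH n (ltnSn n) npos.
have := ler_wpM2l L0 (log3S_le R npos).
suff : L * (n%:R * ln 3)^-1 <= 1 by lra.
have ln3 := ln3_gt0 R.
rewrite ler_pdivrMr ?mulr_gt0 ?ltr0n // mul1r -ler_pdivrMr //.
rewrite (le_trans (ltW (truncnS_gt _))) // ler_nat.
exact: ltnW.
Qed.

Lemma finite_log3_le (R : realType) (x : R) :
  finite_set [set n : nat | log3 n%:R <= x].
Proof.
have l3 := ln3_gt0 R.
apply: (@sub_finite_set _ _ `I_(Num.truncn (expR (x * ln 3))).+1); last first.
  exact: finite_II.
case=> [//|n] /=; rewrite ler_pdivrMr // -ler_expR lnK ?posrE ?ltr0n // => nx.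
by rewrite -(ltr_nat R) (le_lt_trans nx) // truncnS_gt.
Qed.

Theorem theorem4 (R : realType) (P : {fset nat}) (q p : nat)
  (P_neq0 : P != fset0)
  (P_prime : forall r : nat, r \in P -> prime r)
  (q_in : q \in P)
  (q_min : forall r : nat, r \in P -> (q <= r)%N)
  (p_in : p \in P)
  (p_min : forall r : nat, r \in P -> logcomplexity R p <= logcomplexity R r) :
  (forall a b : R,
      logcomplexity R p <= a -> a < b ->
      b <= logcomplexity R q + (q%:R - 1) / log3 q%:R ->
      exists n : nat, (1 < n)%N /\ a < logcomplexityP R P n < b) /\
  (forall eps : R, 0 < eps ->
      finite_set [set n : nat | (1 < n)%N /\
        3 <= logcomplexityP R P n < logcomplexity R p - eps]).
Proof.
split=> [a b pa ab bU|eps eps0]; first exact: logcomplexityP_dense pa ab bU.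
have L0 : 0 <= logcomplexity R p by rewrite divr_ge0 ?log3_ge0.
have [K KP] := @complexityP_ge R P _ P_prime L0 p_min.
(* The two bounds on [complexityP P n] leave [eps * log3 n <= K]. *)
apply: sub_finite_set (finite_log3_le (K / eps)) => n /= [n1 /andP[_]].
rewrite ltr_pdivrMr ?log3_gt0 // ler_pdivlMr //.
by have := KP _ (ltnW n1); lra.
Qed.
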